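(* If a finite simple graph has at most $k$ holes, then it has competition number at most $k+1$.
   Context: A hole in a graph is a subset of at least $4$ vertices that induces a simple cycle (i.e. an induced cycle of length at least $4$). The competition graph of an acyclic directed graph $D$ is the undirected graph on the same vertex set as $D$ in which two distinct vertices $u,v$ are adjacent if and only if there is a vertex $w$ such that $(u,w)$ and $(v,w)$ are arcs of $D$. The competition number of an undirected graph $G$ is the least number $k\ge 0$ of isolated vertices that have to be added to $G$ so that the resulting graph is the competition graph of an acyclic directed graph. All graphs are finite and simple. *)

(* Defs.v *)
From mathcomp Require Import all_boot.
From mathcomp Require Import boolp.

Set Implicit Arguments.
Unset Strict Implicit.
Unset Printing Implicit Defensive.

Record sgraph := SGraph {
  vertex :> finType;
  adj : rel vertex;
  adj_sym : symmetric adj;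
  adj_irr : irreflexive adj }.

(* The vertices of the hole S, listed by c in cyclic order; [next c x] is the
   cyclic successor of x in c. Two vertices of S are adjacent exactly when
   they are consecutive in c, i.e. S induces the cycle c. *)
Definition is_hole (G : sgraph) (S : {set G}) : bool :=
  (4 <= #|S|) &&
  [exists c : #|S|.-tuple G,
    [&& uniq c, S == [set x in c] &
        [forall x in S, forall y in S,
           adj x y == ((y == next c x) || (x == next c y))]]].

Definition holes (G : sgraph) : {set {set G}} := [set S | is_hole S].

(* Cycles of length 1 (loops) and 2 are excluded as well. *)
Definition acyclic (V : finType) (D : rel V) : Prop :=
  forall c : seq V, ucycle D c -> c = [::].

Section CompetitionGraph.
Variables (V : finType) (D : rel V).

Definition competition_adj : rel V :=
  fun u v => (u != v) && [exists w, D u w && D v w].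

Lemma competition_adj_sym : symmetric competition_adj.
Proof.
move=> u v; rewrite /competition_adj eq_sym; congr (_ && _).
by apply: eq_existsb => w; rewrite andbC.
Qed.

Lemma competition_adj_irr : irreflexive competition_adj.
Proof. by move=> u; rewrite /competition_adj eqxx. Qed.

Definition competition_graph : sgraph :=
  SGraph competition_adj_sym competition_adj_irr.
End CompetitionGraph.

Section AddIsolated.
Variables (G : sgraph) (k : nat).

Definition add_isolated_adj : rel (G + 'I_k)%type :=
  fun u v => match u, v with inl x, inl y => adj x y | _, _ => false end.

Lemma add_isolated_adj_sym : symmetric add_isolated_adj.
Proof. by move=> [x|i] [y|j] //=; exact: adj_sym. Qed.

Lemma add_isolated_adj_irr : irreflexive add_isolated_adj.
Proof. by move=> [x|i] //=; exact: adj_irr. Qed.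

Definition add_isolated : sgraph :=
  SGraph add_isolated_adj_sym add_isolated_adj_irr.
End AddIsolated.

Definition is_competition_graph (G : sgraph) : Prop :=
  exists D : rel G, acyclic D /\ @adj G =2 @adj (competition_graph D).

(* One new vertex for each pair (x, y), the common prey of x and y when they
   are adjacent, always suffices. *)
Lemma ex_competition_number (G : sgraph) :
  exists k, `[< is_competition_graph (add_isolated G k) >].
Proof.
exists #|{: G * G}|; apply/asboolP.
pose prey (z : G) (i : 'I_#|{: G * G}|) :=
  adj (enum_val i).1 (enum_val i).2 &&
  ((z == (enum_val i).1) || (z == (enum_val i).2)).
pose D : rel (add_isolated G #|{: G * G}|) :=
  fun u v => match u, v with inl z, inr i => prey z i | _, _ => false end.
exists D; split.
  move=> [|u [|v c]] //.
  - by case: u => [x|i]; rewrite /ucycle.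
  - case: u => [x|i]; case: v => [y|j]; rewrite /ucycle /= ?andbF //.
    by case: c => [|w c] /=; rewrite andbF.
have noprey (w : add_isolated G #|{: G * G}|) i : D (inr i) w = false by [].
move=> u v; rewrite /= /competition_adj.
case: u => [x|i]; last first.
  by symmetry; apply/negbTE/negP=> /andP[_ /existsP[w]]; rewrite noprey.
case: v => [y|j]; last first.
  by symmetry; apply/negbTE/negP=> /andP[_ /existsP[w]]; rewrite noprey andbF.
apply/idP/idP => [/= xy | /andP[nxy /existsP[[z|i]]] //=].
  apply/andP; split; first by apply/eqP => -[exy]; rewrite exy adj_irr in xy.
  apply/existsP; exists (inr (enum_rank (x, y))).
  by rewrite /= /prey enum_rankK /= xy !eqxx orbT.
rewrite /prey => /andP[/andP[a /orP[]/eqP ex] /andP[_ /orP[]/eqP ey]].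
- by rewrite ex ey eqxx in nxy.
- by rewrite ex ey.
- by rewrite ex ey adj_sym.
- by rewrite ex ey eqxx in nxy.
Qed.

Definition competition_number (G : sgraph) : nat :=
  ex_minn (ex_competition_number G).

(* Main.v *)
Require Import Defs.
From mathcomp Require Import all_boot.
From mathcomp Require Import boolp zify.

Set Implicit Arguments.
Unset Strict Implicit.
Unset Printing Implicit Defensive.

(** Ordering the vertices so that prey comes before its predators turns the
    construction of an acyclic digraph into a budget game.  The budget
    starts at the number of isolated vertices added.  Covering edges by a
    clique costs one unit, the clique becoming the set of predators of a
    common prey; once all the edges at a vertex v are covered, v can be
    deleted, and this earns one unit since v can be the prey of a clique
    contained in what is left.  It suffices to show that with one unit more
    than the number of holes the game can always be played to the end, for
    which it is enough to find in every nonempty graph a vertex v whose edges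
    are covered by at most t + 1 cliques, where t is the number of holes
    through v: deleting v leaves a graph with t fewer holes, and the budget
    has dropped by at most t ([exists_prey_schedule]).

    Such a v is an avoidable vertex, i.e. one for which any two neighbours
    are joined by a path whose inner vertices are neither v nor adjacent to v
    ([exists_avoidable]).  If the two neighbours are distinct and not
    adjacent, a shortest such path closes up through v to a hole, in which
    they are the only neighbours of v ([hole_through]).  Pick one neighbour
    of v on each hole through v.  The neighbours that were not picked form a
    clique, as two nonadjacent ones would lie on a hole on which neither was
    picked.  This clique together with v, and the edges from v to the at
    most t picked vertices, are the required cliques ([clique_cover_at]). *)

(** * Shortest paths and acyclic relations *)

Section ShortestPath.
Variables (T : finType) (e : rel T).

Lemma shortest_path (a b : T) : connect e a b ->
  exists p, [/\ path e a p, last a p = b, uniq (a :: p) &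
    forall i j, i.+1 < j -> j < size (a :: p) ->
      ~~ e (nth a (a :: p) i) (nth a (a :: p) j)].
Proof.
move=> ab.
pose Q n := [exists p : n.-tuple T, path e a p && (last a p == b)].
have exQ : exists n, Q n.
  have [p ep eb] := connectP ab.
  by exists (size p); apply/existsP; exists (in_tuple p); rewrite /= ep eb eqxx.
case: (ex_minnP exQ) => n /existsP[p0 /andP[ep0 /eqP eb0]] min_n.
have {}min_n p : path e a p -> last a p = b -> n <= size p.
  move=> ep eb; apply: min_n; apply/existsP; exists (in_tuple p).
  by rewrite /= ep eb eqxx.
case/shortenP: ep0 eb0 => p ep up sub eb.
have szp : size p <= n.
  by rewrite -(size_tuple p0); apply: uniq_leq_size => //; case/andP: up.
exists p; split=> // i j ij jp; apply/negP => eij.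
have : n <= size (take i p ++ drop j.-1 p).
  case: j ij jp eij => // j; rewrite /= !ltnS => ij jp eij.
  (* The edge from entry i to entry j of a :: p shortcuts the path; entry j.+1
     of a :: p is entry j of p. *)
  have pE : p = take j p ++ nth a p j :: drop j.+1 p.
    by rewrite -drop_nth // cat_take_drop.
  rewrite (drop_nth a) //.
  have ilast : last a (take i p) = nth a (a :: p) i.
    have ip : i < size p := ltn_trans ij jp.
    rewrite -nth_last size_take ip.
    case: i ip {ij eij} => [|i] ip /=; first by rewrite take0.
    by rewrite nth_take.
  apply: min_n.
    rewrite cat_path take_path //= ilast eij /=.
    by move: ep; rewrite {1}pE cat_path /= => /and3P[].
  by rewrite last_cat /= -eb [in RHS]pE last_cat.
rewrite size_cat size_take size_drop; move: ij jp szp => /=.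
by case: ifP; lia.
Qed.

End ShortestPath.

Lemma acyclic_rank (V : finType) (D : rel V) (r : V -> nat) :
  (forall u w, D u w -> r w < r u) -> acyclic D.
Proof.
move=> lt_r [//|x c] /andP[/= cyc _].
have desc : path (fun u w => r w < r u) x (rcons c x) by apply: sub_path cyc.
have tr : transitive (fun u w => r w < r u).
  by move=> u v w lt1 lt2; apply: ltn_trans lt2 lt1.
have/allP/(_ x) := order_path_min tr desc.
by rewrite mem_rcons inE eqxx ltnn => /(_ isT).
Qed.

(** * Holes through a vertex *)

Section Graph.
Variable G : sgraph.
Implicit Types (x y z v a b : G) (U W X C S : {set G}).

(** The relation [adj] is only constrained on increasing pairs of positions,
    so that the wrap-around of the cycle is the single pair of positions 0
    and [(size c).-1]. *)
Lemma hole_of_cycle (c : seq G) x0 : uniq c -> 4 <= size c ->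
  (forall i j, i < j -> j < size c ->
    adj (nth x0 c i) (nth x0 c j) = (j == i.+1) || (i == 0) && (j == (size c).-1)) ->
  is_hole [set x in c].
Proof.
move=> uc sc adjc.
have cardc : #|[set x in c]| = size c by rewrite cardsE; apply/card_uniqP.
rewrite /is_hole cardc sc /=; apply/existsP; exists (in_tuple c) => /=.
rewrite uc eqxx /=.
have nextE i : i < size c ->
    next c (nth x0 c i) = nth x0 c (if i.+1 == size c then 0 else i.+1).
  move=> ic; rewrite next_nth mem_nth // index_uniq //.
  case: c ic {uc sc adjc cardc} => // y c ic; rewrite eqSS.
  have [->|ne] := eqVneq i (size c); first by rewrite nth_default.
  by apply: set_nth_default; rewrite ltn_neqAle ne.
have wrap i : i < size c -> (if i.+1 == size c then 0 else i.+1) < size c.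
  move=> ic; have [_|ne] := eqVneq; first exact: leq_ltn_trans ic.
  by rewrite ltn_neqAle ne.
have adjE i j : i < j -> j < size c -> adj (nth x0 c i) (nth x0 c j) =
    (nth x0 c j == next c (nth x0 c i)) || (nth x0 c i == next c (nth x0 c j)).
  move=> ij jc; rewrite adjc // !nextE ?(ltn_trans ij) //.
  rewrite !nth_uniq ?wrap ?(ltn_trans ij) //.
  move: (size c) jc => n jn.
  have -> : (i.+1 == n) = false by lia.
  by case: (eqVneq j.+1 n) => [<-|nej] /=; lia.
apply/forall_inP => x; rewrite inE => xc; apply/forall_inP => y.
rewrite inE => yc; apply/eqP; rewrite -(nth_index x0 xc) -(nth_index x0 yc).
move: (index x c) (index y c) (index_mem x c) (index_mem y c).
rewrite xc yc => i j ic jc.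
case: (ltngtP i j) => [ij|ji|<-].
- exact: adjE.
- by rewrite adj_sym orbC; exact: adjE.
- rewrite adj_irr orbb nextE // nth_uniq ?wrap //.
  by move: (size c) sc => n; case: (eqVneq i.+1 n) => [<-|_] /=; lia.
Qed.

(** Adjacency in the subgraph induced by X, kept on the vertices of G so that
    paths in different induced subgraphs can be compared. *)
Definition inside X : rel G := [rel x y | [&& x \in X, y \in X & adj x y]].

Lemma inside_connect_sym X : connect_sym (inside X).
Proof.
by apply: sym_connect_sym => x y; rewrite /inside/= adj_sym andbCA.
Qed.

Lemma inside_connectS X X' x y :
  X \subset X' -> connect (inside X) x y -> connect (inside X') x y.
Proof.
move=> /subsetP sub; apply: connect_sub => {}x {}y /and3P[xX yX xy].
by apply: connect1; rewrite /inside /= !sub.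
Qed.

Lemma path_inside X x p : path (inside X) x p -> {subset p <= X}.
Proof.
elim: p x => //= y p IH x /andP[/and3P[_ yX _] /IH pX] z.
by rewrite inE => /predU1P[->//|/pX].
Qed.

Definition far W v := [set x in W | (x != v) && ~~ adj v x].

(** The hole is a shortest path from a to b followed by v.  It is chordless
    because the path is, and because v has no neighbour among the inner
    vertices; it has at least four vertices because a and b are not
    adjacent. *)
Lemma hole_through W v a b :
  v \in W -> a \in W -> b \in W -> adj v a -> adj v b -> a != b ->
  ~~ adj a b -> connect (inside (a |: (b |: far W v))) a b ->
  exists S, [/\ is_hole S, S \subset W, v \in S, a \in S &
             forall x, x \in S -> adj v x -> (x == a) || (x == b)].
Proof.
move=> vW aW bW va vb neq_ab nab.
set X := a |: _ => /shortest_path[p [ep eb up chordless]].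
have pX x : x \in a :: p -> x \in X.
  rewrite inE => /predU1P[->|]; first by rewrite !inE eqxx.
  exact: path_inside ep x.
have XadjP x : x \in X -> adj v x = (x == a) || (x == b).
  rewrite !inE; case: (eqVneq x a) => [->//|_] /=.
  by case: (eqVneq x b) => [->//|_] /= /and3P[_ _ /negbTE].
have vX : v \notin X.
  rewrite !inE eqxx andbF orbF; apply/norP; split.
    by apply: contraTneq va => <-; rewrite adj_irr.
  by apply: contraTneq vb => <-; rewrite adj_irr.
have szp : 1 < size p.
  case: p ep eb {up chordless pX} => [|y [|z p]] //=.
    by move=> _ eab; rewrite eab eqxx in neq_ab.
  by rewrite andbT => /and3P[_ _ ay] yb; rewrite -yb ay in nab.
have nth_b : nth a (a :: p) (size p) = b by rewrite -last_nth.
have uc : uniq (v :: a :: p).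
  by rewrite cons_uniq up andbT; apply: contra vX => /pX.
have aS : a \in [set x in v :: a :: p] by rewrite !inE eqxx orbT.
exists [set x in v :: a :: p]; split=> //.
- apply: (@hole_of_cycle _ a) => // -[|i] [|j] // ij jc.
    rewrite [nth _ _ 0]/= [nth _ _ j.+1]/=.
    rewrite XadjP; last by apply/pX/mem_nth.
    have -> : (nth a (a :: p) j == a) = (j == 0).
      by rewrite -[RHS](@nth_uniq _ a (a :: p)).
    by rewrite -nth_b nth_uniq.
  rewrite /= orbF !eqSS; move: ij jc; rewrite !ltnS => ij jc.
  case: (eqVneq j i.+1) => [ej|nej].
    subst j; move/(pathP a): ep => /(_ i); rewrite -ltnS => /(_ jc).
    by case/and3P.
  have ij' : i.+1 < j by rewrite ltn_neqAle eq_sym nej.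
  apply/negbTE; apply: contra (chordless _ _ ij' jc) => aij.
  by rewrite /inside /= !pX ?mem_nth // (ltn_trans ij).
- apply/subsetP => x; rewrite inE in_cons => /predU1P[->//|/pX].
  by rewrite !inE => /or3P[/eqP->|/eqP->|/andP[]].
- by rewrite !inE eqxx.
- move=> x; rewrite inE in_cons => /predU1P[->|/pX/XadjP<-//].
  by rewrite adj_irr.
Qed.

(** * Avoidable vertices *)

Definition avoidable W v := v \in W /\
  {in W &, forall a b, adj v a -> adj v b ->
    connect (inside (a |: (b |: far W v))) a b}.

Definition connected C := [forall x in C, forall y in C, connect (inside C) x y].

Lemma connectedU1 C x y :
  connected C -> y \in C -> adj x y -> connected (x |: C).
Proof.
move=> conC yC xy.
have to_y z : z \in x |: C -> connect (inside (x |: C)) z y.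
  case/setU1P=> [->|zC].
    by apply: connect1; rewrite /inside /= !inE eqxx yC xy orbT.
  apply: (inside_connectS (subsetUr _ _)).
  by move/forall_inP: conC => /(_ z zC)/forall_inP; apply.
apply/forall_inP => z zC; apply/forall_inP => t tC.
by apply: (connect_trans (to_y z zC)); rewrite inside_connect_sym to_y.
Qed.

(** Among the connected sets C with no neighbour of some vertex v outside C,
    take a largest one, and let NC be the set of vertices with a neighbour in
    C.  Every vertex w outside C and NC is adjacent to all the vertices s of
    NC outside C, for otherwise s could be added to C.  Let w be avoidable,
    by induction, in the graph induced by the vertices M outside C and NC.
    Then w is avoidable in W: its neighbours avoid C, two of them in NC are
    linked through C, two in M by the choice of w, and one in NC is adjacent
    to one in M.  If C is empty then W is a clique, as [set a] would be a
    larger choice for distinct nonadjacent a and b. *)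
Lemma exists_avoidable W : W != set0 -> exists v, avoidable W v.
Proof.
move: {2}#|W|.+1 (ltnSn #|W|) => n; elim: n W => // n IH W.
rewrite ltnS => leWn /set0Pn[v0 v0W].
pose P (Cv : {set G} * G) := [&& Cv.1 \subset W, connected Cv.1,
  Cv.2 \in W :\: Cv.1 & [forall x in Cv.1, ~~ adj Cv.2 x]].
have P0 : P (set0, v0).
  rewrite /P /= sub0set !inE v0W /=.
  by apply/andP; split; apply/forall_inP => x; rewrite inE.
case: (@arg_maxnP _ _ P (fun Cv => #|Cv.1|) P0) => -[C v].
rewrite /P => /and4P[/= CW conC]; rewrite inE => /andP[vC vW] /forall_inP nvC maxC.
pose NC := [set y in W | [exists x in C, adj y x]].
pose M := W :\: C :\: NC.
have vM : v \in M.
  rewrite !inE vC vW /= andbT; apply/exists_inP => -[x xC vx].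
  by have := nvC x xC; rewrite vx.
have MNC w s : w \in M -> s \in W -> s \notin C -> s \in NC -> adj w s.
  rewrite !inE => /andP[wN /andP[wC wW]] sW sC /andP[_ /exists_inP[c cC sc]].
  apply: contraNT wN => nws; rewrite wW /=; apply/exists_inP.
  have [/existsP[c' /andP[c'C wc']]|/existsPn nwC] := boolP [exists x, (x \in C) && adj w x].
    by exists c'.
  have nes : w != s.
    by apply: contra (nwC c) => /eqP->; rewrite cC sc.
  have : #|s |: C| <= #|C|.
    apply: (maxC (s |: C, w)); apply/and4P; split=> /=.
    - by rewrite subUset sub1set sW.
    - exact: connectedU1 conC cC sc.
    - by rewrite !inE negb_or nes wC wW.
    - apply/forall_inP => x /setU1P[->//|xC].
      by move: (nwC x); rewrite xC.
  by rewrite cardsU1 sC ltnn.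
have [C0|C_n0] := eqVneq C set0.
  exists v0; split=> // a b aW bW _ _.
  have [->|neq_ab] := eqVneq a b; first exact: connect0.
  have [ab|nab] := boolP (adj a b).
    by apply: connect1; rewrite /inside /= !inE !eqxx orbT.
  have := maxC ([set a], b); rewrite C0 cards0 cards1 => /(_ _) H.
  have /H // : P ([set a], b).
  apply/and4P; split=> /=.
  - by rewrite sub1set.
  - by apply/forall_inP => x /set1P->; apply/forall_inP => y /set1P->; apply: connect0.
  - by rewrite !inE eq_sym neq_ab.
  - by apply/forall_inP => x /set1P->; rewrite adj_sym.
have ltMn : #|M| < n.
  apply: leq_trans leWn; apply: proper_card; apply/properP; split.
    by rewrite /M setDDl subsetDl.
  by have [c cC] := set0Pn _ C_n0; exists c; rewrite ?(subsetP CW) // !inE cC /= andbF.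
have [|w [wM linkM]] := IH M ltMn; first by apply/set0Pn; exists v.
have [wN wC wW] : [/\ w \notin NC, w \notin C & w \in W].
  by move: wM; rewrite !in_setD => /and3P.
have nwC x : x \in C -> ~~ adj w x.
  move=> xC; apply: contra wN => wx; rewrite inE wW; apply/exists_inP.
  by exists x.
have CF : C \subset far W w.
  apply/subsetP => x xC; rewrite inE (subsetP CW) // nwC // andbT.
  by apply: contraNneq wC => <-.
have MF : far M w \subset far W w.
  by apply/subsetP => x; rewrite !inE => /andP[/and3P[_ _ ->]].
exists w; split=> // a b aW bW wa wb; set X := a |: _.
have [aX bX] : a \in X /\ b \in X by rewrite !inE !eqxx orbT.
have CX : C \subset X.
  apply: subset_trans CF _; apply: subset_trans (subsetUr _ _).
  exact: subsetUr.
have aC : a \notin C by apply: contraL wa => /nwC.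
have bC : b \notin C by apply: contraL wb => /nwC.
have [aN|aN] := boolP (a \in NC); have [bN|bN] := boolP (b \in NC).
- move: aN bN; rewrite !inE => /andP[_ /exists_inP[c cC ac]].
  move=> /andP[_ /exists_inP[d dC bd]].
  apply: (@connect_trans _ _ c).
    by apply: connect1; rewrite /inside /= aX ac (subsetP CX).
  apply: (@connect_trans _ _ d); last first.
    by apply: connect1; rewrite /inside /= bX adj_sym bd (subsetP CX).
  apply: inside_connectS CX _.
  by move/forall_inP: conC => /(_ c cC)/forall_inP; apply.
- apply: connect1; rewrite /inside /= aX bX adj_sym MNC //.
  by rewrite !in_setD bN bC.
- apply: connect1; rewrite /inside /= aX bX MNC //.
  by rewrite !in_setD aN aC.
- apply: inside_connectS (linkM a b _ _ wa wb); last 2 first.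
  + by rewrite !in_setD aN aC.
  + by rewrite !in_setD bN bC.
  by rewrite !setUS.
Qed.

(** * Cheap clique covers of the edges at a vertex *)

Definition clique C := {in C &, forall x y, x != y -> adj x y}.

Definition holes_in W := [set S in holes G | S \subset W].

(** The last clause is the budget inequality: the cliques used at v are at most
    one more than the holes destroyed by deleting v. *)
Lemma clique_cover_at W : W != set0 ->
  exists v, v \in W /\ exists cs : seq {set G},
    [/\ {in cs, forall C, C \subset W /\ clique C},
        {in W, forall x, adj v x -> exists2 C, C \in cs & (v \in C) && (x \in C)} &
        size cs + #|holes_in (W :\ v)| <= #|holes_in W|.+1].
Proof.
move=> /exists_avoidable[v [vW linkv]]; exists v; split=> //.
pose H := [set S in holes_in W | v \in S].
pose f S := odflt v [pick x in S | adj v x].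
pose T := [set x in f @: H | (x \in W) && adj v x].
pose K := [set x in W | adj v x && (x \notin T)].
have sTH : #|T| <= #|H|.
  apply: leq_trans (leq_imset_card f H); apply: subset_leq_card.
  by apply/subsetP => x; rewrite inE => /andP[].
(* The hole through nonadjacent a and b in K has no other neighbour of v, so
   its picked vertex is a or b, contradicting that neither is in T. *)
have cliqueK : clique K.
  move=> a b /[!inE] /and3P[aW va aT] /and3P[bW vb bT] ab.
  rewrite va vb aW bW !andbT in aT bT; apply: contraT => nab.
  have [S [hS SW vS aS Sab]] :=
    hole_through vW aW bW va vb ab nab (linkv a b aW bW va vb).
  have SH : S \in H by rewrite !inE hS SW.
  have : f S \in [set a; b].
    rewrite /f; case: pickP => [x /andP[xS vx]|/(_ a)] /=.
      by rewrite !inE Sab.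
    by rewrite aS va.
  by rewrite !inE => /orP[]/eqP eS; move: aT bT; rewrite -eS imset_f.
exists ((v |: K) :: [seq [set v; t] | t <- enum T]); split.
- move=> C; rewrite inE => /predU1P[->|/mapP[t]].
    split; first by rewrite subUset sub1set vW; apply/subsetP => x /[!inE] /andP[].
    move=> x y /setU1P[->|xK] /setU1P[->|yK]; rewrite ?eqxx //.
    + by move: yK; rewrite inE => /and3P[].
    + by rewrite adj_sym; move: xK; rewrite inE => /and3P[].
    + exact: cliqueK.
  rewrite mem_enum inE => /and3P[_ tW vt] ->; split.
    by apply/subsetP => x /set2P[]->.
  by move=> x y /set2P[]-> /set2P[]->; rewrite ?eqxx // adj_sym.
- move=> x xW vx; have [xT|xT] := boolP (x \in T).
    exists [set v; x]; last by rewrite !inE !eqxx orbT.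
    by rewrite inE (map_f (fun t => [set v; t])) ?orbT // mem_enum.
  exists (v |: K); first by rewrite inE eqxx.
  by rewrite setU11 setU1r // inE xW vx.
- rewrite /= size_map -cardE addSn ltnS.
  rewrite -(cardsID [set S : {set G} | v \in S] (holes_in W)).
  apply: leq_add.
    by apply: leq_trans sTH _; apply: subset_leq_card; apply/subsetP => S; rewrite !inE.
  apply: subset_leq_card; apply/subsetP => S.
  by rewrite !inE subsetD1 => /and3P[-> -> ->].
Qed.

(** * Playing the budget game *)

(** A play of the game: s lists the vertices in the order of their deletion,
    and cs lists the cliques in the order of their use.  The first q cliques
    get new vertices as prey, and the clique at position q + i gets the i-th
    vertex of s, so the bound on [index x s] says that the vertices of a
    clique are deleted after its prey. *)
Definition prey_schedule q W (s : seq G) (cs : seq {set G}) :=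
  [/\ uniq s /\ s =i W,
      size cs <= q + size s,
      forall j x, x \in nth set0 cs j -> x \in s /\ j < q + index x s,
      {in cs, forall C, clique C} &
      {in W &, forall x y, adj x y ->
         exists2 C, C \in cs & (x \in C) && (y \in C)}].

Lemma exists_prey_schedule k W : #|holes_in W| <= k ->
  exists s cs, prey_schedule k.+1 W s cs.
Proof.
move: {2}#|W|.+1 (ltnSn #|W|) => n.
elim: n W k => // n IH W k leWn leWk; have [W0|W_n0] := eqVneq W set0.
  exists [::], [::]; rewrite W0; split=> //.
  - by split=> // x; rewrite inE.
  - by move=> j x; rewrite nth_nil inE.
  - by move=> x y; rewrite inE.
have [v [vW [ds [dsW coverv leds]]]] := clique_cover_at W_n0.
have leW'n : #|W :\ v| < n by move: leWn; rewrite (cardsD1 v) vW.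
have leW'k : #|holes_in (W :\ v)| <= k.+1 - size ds by lia.
have [s [cs [[us sW] szcs rankcs cliquecs covercs]]] := IH _ _ leW'n leW'k.
have sWv x : (x \in v :: s) = (x \in W).
  by rewrite inE sW !inE; case: eqVneq => // ->.
have vs : v \notin s by rewrite sW !inE eqxx.
exists (v :: s), (ds ++ cs); split=> //=.
- by rewrite vs.
- rewrite size_cat; lia.
- move=> j x; rewrite nth_cat; case: ifP => [jd|/negbT].
    move=> /(subsetP (dsW _ (mem_nth set0 jd)).1) xW.
    by rewrite sWv; split=> //; lia.
  rewrite -leqNgt => dj /rankcs[xs]; case: eqVneq => [ev|_] lt.
    by rewrite ev xs in vs.
  by rewrite inE xs orbT; split=> //; lia.
- by move=> C; rewrite mem_cat => /orP[/dsW[]//|/cliquecs].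
- move=> x y xW yW xy.
  have [ex|nx] := eqVneq x v.
    subst x; have [C Cds /andP[vC yC]] := coverv y yW xy.
    by exists C; rewrite ?mem_cat ?Cds ?vC.
  have [ey|ny] := eqVneq y v.
    subst y; rewrite adj_sym in xy.
    have [C Cds /andP[vC xC]] := coverv x xW xy.
    by exists C; rewrite ?mem_cat ?Cds ?vC ?andbT.
  have [||C Ccs xyC] := covercs x y _ _ xy; rewrite ?inE ?nx ?ny //.
  by exists C; rewrite ?mem_cat ?Ccs ?orbT.
Qed.

(** The position [pos w] of the clique that preys on w decreases along the
    arcs, whence acyclicity. *)
Lemma prey_schedule_competition q s cs : prey_schedule q [set: G] s cs ->
  is_competition_graph (add_isolated G q).
Proof.
move=> [[us sG] szcs rankcs cliquecs covercs].
pose pos (w : add_isolated G q) : nat :=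
  match w with inl x => q + index x s | inr i => i end.
pose D (u w : add_isolated G q) : bool :=
  match u with inl x => x \in nth set0 cs (pos w) | inr _ => false end.
exists D; split.
  apply: (@acyclic_rank _ _ pos) => -[x|//] w /rankcs[_].
  exact.
have not_predator i w : D (inr i) w = false by [].
move=> [x|i] [y|j] /=; rewrite /competition_adj;
  try by symmetry; apply/negbTE/negP=> /andP[_ /existsP[w]];
    rewrite !not_predator ?andbF.
apply/idP/idP => [xy|/andP[nxy /existsP[w /andP[/= xC yC]]]]; last first.
  have posw : pos w < size cs.
    by rewrite ltnNge; apply/negP => ge; rewrite nth_default ?inE in xC.
  exact: (cliquecs _ (mem_nth set0 posw)).
apply/andP; split; first by apply/eqP => -[exy]; rewrite exy adj_irr in xy.
have [C /(nthP set0)[j jcs <-] xyC] := covercs x y (in_setT x) (in_setT y) xy.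
apply/existsP; have [jq|qj] := ltnP j q; first by exists (inr (Ordinal jq)).
have js : j - q < size s by rewrite ltn_subLR // (leq_trans jcs).
exists (inl (nth x s (j - q))).
by rewrite /D /pos index_uniq // subnKC.
Qed.

End Graph.

Theorem theorem23 (G : sgraph) (k : nat) :
  #|holes G| <= k -> competition_number G <= k.+1.
Proof.
move=> lek; rewrite /competition_number; case: ex_minnP => m _; apply.
have le_in : #|holes_in [set: G]| <= k.
  apply: leq_trans lek; apply: subset_leq_card; apply/subsetP => S.
  by rewrite inE => /andP[].
have [s [cs sched]] := exists_prey_schedule le_in.
by apply/asboolP; apply: prey_schedule_competition sched.
Qed.
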